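(* For every constant $\varepsilon>0$ there exists a constant $c>1$ and a family of functions $\mathsf{2nmExt}:\{0,1\}^n\times\{0,1\}^n\to\{0,1\}$ such that for any two independent sources $X$ and $Y$ on $\{0,1\}^n$, each of min-entropy at least $k\ge c\log n$, and any functions $f,g:\{0,1\}^n\to\{0,1\}^n$ such that at least one of $f$ and $g$ has no fixed point, it holds that $(\mathsf{2nmExt}(X,Y),\mathsf{2nmExt}(f(X),g(Y)))\approx_\varepsilon (U_1,\mathsf{2nmExt}(f(X),g(Y))).$
   Context: The min-entropy of a random variable $X$ is $H_\infty(X)=\min_{x\in\mathrm{supp}(X)}\log_2(1/\Pr[X=x])$. $U_1$ is a uniform bit independent of everything else. $A\approx_\varepsilon B$ means the statistical distance between the distributions $A$ and $B$ is at most $\varepsilon$. A function $f$ has no fixed point if $f(x)\ne x$ for all $x$.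
   Formalization: The formal statement takes n ≥ 2: for n = 1, log n = 0 makes the min-entropy condition void, and constant sources X, Y give distance 1/2, so the claim fails for ε < 1/2 (for n = 0, log n is undefined). *)

(* Defs.v *)
From HB Require Import structures.
From mathcomp Require Import all_boot all_order all_algebra.
From mathcomp Require Import all_classical all_reals all_analysis.

Set Implicit Arguments.
Unset Strict Implicit.
Unset Printing Implicit Defensive.

Import Order.TTheory GRing.Theory Num.Theory.

Local Open Scope classical_set_scope.
Local Open Scope ring_scope.

Definition log2 (R : realType) (x : R) : R := ln x / ln 2.

(* Distributions on a finite type are represented by their mass functions. *)
Definition law (d : measure_display) (T : measurableType d) (R : realType)
    (P : probability T R) (A : finType) (Z : T -> A) : A -> R :=
  fun a => fine (P (Z @^-1` [set a])).

(* For finite-valued variables the product rule on point events is equivalent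
   to the product rule on all events. *)
Definition independent (d : measure_display) (T : measurableType d)
    (R : realType) (P : probability T R) (A B : finType)
    (X : T -> A) (Y : T -> B) : Prop :=
  forall a b, P (X @^-1` [set a] `&` Y @^-1` [set b]) =
              (P (X @^-1` [set a]) * P (Y @^-1` [set b]))%E.

(* The neutral element +oo of min plays no role: the support of a probability
   mass function is nonempty. *)
Definition min_entropy (R : realType) (A : finType) (p : A -> R) : \bar R :=
  \big[Order.min/+oo%E]_(a : A | p a != 0) (log2 (1 / p a))%:E.

Definition stat_dist (R : realType) (A : finType) (p q : A -> R) : R :=
  2^-1 * \sum_(a : A) `|p a - q a|.

Definition unif_bit (R : realType) : bool -> R := fun=> 2^-1.

Definition prod_law (R : realType) (A B : finType) (p : A -> R) (q : B -> R) :
    A * B -> R :=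
  fun ab => p ab.1 * q ab.2.

Definition no_fixed_point (A : Type) (f : A -> A) : Prop :=
  forall x, f x <> x.

(* Main.v *)
(** The extractor is a random function [s], taken with [K = n ^ c].  The
    distance to a uniform first bit is half the sum over [b] of the absolute
    correlations of the sign [(-1) ^ s (X, Y)] with the event
    [s (f X, g Y) = b].  A function without fixed point has a proper colouring
    with [2 n] colours, so a rectangle [A x B] splits into [2 n] rectangles that
    the map [(f, g)] sends off themselves.  On such a rectangle, given the
    values of [s] outside it, the correlation is a sum of independent signs; its
    exponential moment beats the [2 ^ O(n K)] choices of [A], [B] and of the
    restrictions of [f] and [g], since [K] dominates [n ^ 3].  A linear form
    bounded on all sets of at most [K] points is bounded on all mass functions
    at most [1 / K], which passes from sets to sources. *)

Require Import Defs.
From HB Require Import structures.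
From mathcomp Require Import all_boot all_order all_algebra.
From mathcomp Require Import all_classical all_reals all_analysis.
From mathcomp Require Import ring lra.

Import Order.TTheory GRing.Theory Num.Theory.

Local Open Scope ring_scope.

(** * Exponential moments of signed sums *)

(** By [expR x <= (1 - x)^-1] the left side is at most [2 / (1 - l ^+ 2)], hence at most
    [2 * (1 + 2 * l ^+ 2)] as [l ^+ 2 <= 4^-1]. *)
Lemma expRD_expRN_le (R : realType) (l : R) : `|l| <= 2^-1 ->
  expR l + expR (- l) <= 2 * expR (2 * l ^+ 2).
Proof.
rewrite ler_norml => /andP[l1 l2].
have inv_bound (x : R) : - 2^-1 <= x <= 2^-1 -> expR x <= (1 - x)^-1.
  move=> /andP[x1 x2]; rewrite -[x in expR x]opprK expRN lef_pV2 ?posrE ?expR_gt0//.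
    exact: expR_ge1Dx.
  lra.
have h1 : expR l <= (1 - l)^-1 by apply: inv_bound; rewrite l1 l2.
have h2 : expR (- l) <= (1 - - l)^-1 by apply: inv_bound; lra.
apply: (le_trans (lerD h1 h2)).
have l4 : l ^+ 2 <= 4^-1 by nra.
apply: (@le_trans _ _ (2 * (1 + 2 * l ^+ 2))); last first.
  by rewrite ler_pM2l//; exact: expR_ge1Dx.
have -> : (1 - l)^-1 + (1 - - l)^-1 = 2 / (1 - l ^+ 2).
  by field; rewrite !lt0r_neq0//; lra.
by rewrite ler_pdivrMr; nra.
Qed.

(** With [phi] the pair of tampering maps, averaging over [v] from the joint law of the sources
    gives the probability of the output pair [(false, b)] minus that of [(true, b)]. *)
Definition sign_on (R : realType) (V : finType) (phi : V -> V) (b : bool)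
    (s : {ffun V -> bool}) (v : V) : R :=
  (-1) ^+ s v * (s (phi v) == b)%:R.

Definition flip (V : finType) (v0 : V) (s : {ffun V -> bool}) :
    {ffun V -> bool} := [ffun v => s v (+) (v == v0)].

Lemma flipK (V : finType) (v0 : V) : involutive (flip V v0).
Proof. by move=> s; apply/ffunP => v; rewrite !ffunE addbK. Qed.

(* Flipping [s] at a point [v0] of [E] changes the sign of the term of index
   [v0] and no other term, so averaging over the flip replaces one exponential
   by a hyperbolic cosine. *)
Lemma sum_expR_sign_le (R : realType) (V : finType) (phi : V -> V) (b : bool)
    (D E : {set V}) (l : R) : `|l| <= 2^-1 -> E \subset D ->
    (forall v, v \in D -> phi v \notin D) ->
  \sum_(s : {ffun V -> bool}) expR (l * \sum_(v in E) sign_on R V phi b s v)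
    <= (2 ^ #|V|)%:R * expR (2 * l ^+ 2) ^+ #|E|.
Proof.
move=> hl + hD; move hk : #|E| => k; elim: k => [|k IH] in E hk *.
  move=> _; move/eqP: hk; rewrite cards_eq0 => /eqP ->.
  under eq_bigr do rewrite big_set0 mulr0 expR0.
  by rewrite sumr_const expr0 mulr1 card_ffun card_bool.
move=> sED; have /card_gt0P[v0 v0E] : (0 < #|E|)%N by rewrite hk.
have {}IH : \sum_s expR (l * \sum_(v in E :\ v0) sign_on R V phi b s v)
    <= (2 ^ #|V|)%:R * expR (2 * l ^+ 2) ^+ k.
  apply: IH; last exact: fintype.subset_trans (finset.subsetDl _ _) sED.
  by move: hk; rewrite (cardsD1 v0) v0E => -[].
pose G s := expR (l * \sum_(v in E :\ v0) sign_on R V phi b s v).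
pose t s := l * sign_on R V phi b s v0.
have hphi v : v \in E -> phi v != v0.
  move=> vE; apply: contraTneq (fintype.subsetP sED _ v0E) => <-.
  exact: hD (fintype.subsetP sED _ vE).
have flipG s : G (flip V v0 s) = G s.
  congr (expR (l * _)); apply: eq_bigr => v /finset.setD1P[vv0 vE].
  by rewrite /sign_on !ffunE (negbTE vv0) (negbTE (hphi _ vE)) !addbF.
have flipt s : t (flip V v0 s) = - t s.
  rewrite /t /sign_on !ffunE eqxx (negbTE (hphi _ v0E)) addbF.
  by case: (s v0); rewrite /= ?expr0 ?expr1; ring.
have -> : \sum_s expR (l * \sum_(v in E) sign_on R V phi b s v)
    = \sum_s expR (t s) * G s.
  apply: eq_bigr => s _.
  by rewrite -expRD -mulrDr (big_setD1 v0).
have e2 : \sum_s expR (t s) * G s = \sum_s expR (- t s) * G s.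
  rewrite (reindex_inj (inv_inj (flipK V v0))).
  by apply: eq_bigr => s _; rewrite flipG flipt.
rewrite -(ler_pM2l (ltr0n R 2)) mulr_natl mulr2n {2}e2 -big_split /=.
apply: (@le_trans _ _ (\sum_s 2 * expR (2 * l ^+ 2) * G s)).
  apply: ler_sum => s _; rewrite -mulrDl ler_wpM2r ?expR_ge0//.
  (* Where the event fails [t s] is zero and the two exponentials add up to 2; otherwise the
     hyperbolic cosine bound applies. *)
  rewrite /t /sign_on; case: (s v0); case: (_ == b);
    rewrite ?expr1 ?expr0 ?mulr1 ?mul1r ?mulrN1 ?mulr0 ?oppr0 ?opprK ?expR0.
  - by rewrite addrC expRD_expRN_le.
  - have : 1 <= expR (2 * l ^+ 2) by rewrite -expR0 ler_expR mulr_ge0// sqr_ge0.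
    lra.
  - by rewrite expRD_expRN_le.
  - have : 1 <= expR (2 * l ^+ 2) by rewrite -expR0 ler_expR mulr_ge0// sqr_ge0.
    lra.
rewrite -mulr_sumr (exprS _ k) [X in _ <= _ * X]mulrCA [leRHS]mulrA.
by rewrite ler_wpM2l// mulr_ge0// expR_ge0.
Qed.

(** * Union bound over rectangles and restricted maps *)

(* A partial function on [T] with a domain of at most [K] points, listed as a
   sequence of [K] argument-value pairs. *)
Definition graph_dom (T : finType) (K : nat) (u : {ffun 'I_K -> T * T}) :
  {set T} := [set (u i).1 | i : 'I_K].

Definition graph_app (T : finType) (K : nat) (u : {ffun 'I_K -> T * T})
    (x : T) : T := if [pick i | (u i).1 == x] is Some i then (u i).2 else x.

(** A set of at most [K] points and a function on it share one of [#|T| ^ (2 * K)] codes, few enough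
    for the union bound. *)
Lemma graph_ex (T : finType) (K : nat) (A : {set T}) (f : T -> T) :
  A != finset.set0 -> (#|A| <= K)%N ->
  exists u : {ffun 'I_K -> T * T},
    graph_dom T K u = A /\ {in A, graph_app T K u =1 f}.
Proof.
move=> /finset.set0Pn[x0 x0A] AK; pose a (i : 'I_K) := nth x0 (enum A) i.
have aA i : a i \in A.
  (* Positions past the end repeat [x0], so the listed domain stays inside [A]. *)
  rewrite /a; have [lt|ge] := ltnP i (size (enum A)).
    by rewrite -mem_enum mem_nth.
  by rewrite nth_default.
exists [ffun i => (a i, f (a i))].
have ex x : x \in A -> exists i, a i = x.
  move=> xA; have lt : (index x (enum A) < K)%N.
    by rewrite (leq_trans _ AK)// cardE index_mem mem_enum.
  by exists (Ordinal lt); rewrite /a /= nth_index// mem_enum.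
split.
  apply/setP => x; apply/imsetP/idP => [[i _ ->]|/ex[i <-]].
    by rewrite ffunE /= aA.
  by exists i; rewrite ?ffunE.
move=> x xA; rewrite /graph_app; case: pickP => [i|].
  by rewrite !ffunE /= => /eqP ->.
by have [i ai] := ex _ xA => /(_ i); rewrite ffunE /= ai eqxx.
Qed.

Definition pair_map (T : finType) (f g : T -> T) (v : T * T) : T * T :=
  (f v.1, g v.2).

Lemma exists_le_mean (R : realType) (I : finType) (F : I -> R) (m : R) :
  (0 < #|I|)%N -> \sum_i F i <= #|I|%:R * m -> exists i, F i <= m.
Proof.
move=> I0 h; apply: contrapT => /forallNP no.
have /card_gt0P[i0 _] := I0.
suff : #|I|%:R * m < \sum_i F i by rewrite ltNge h.
rewrite mulr_natl -sumr_const; apply: ltr_sum.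
  by apply/hasP; exists i0; rewrite ?mem_index_enum.
by move=> i _; rewrite ltNge; apply/negP/no.
Qed.

(* Union bound over the sign, the value [b] and the restrictions of [f] to [A]
   and of [g] to [B]. *)
Lemma exists_pseudorandom (R : realType) (T : finType) (K : nat) (l : R) :
    (0 < #|T|)%N -> 0 < l -> l <= 2^-1 ->
  exists s : {ffun T * T -> bool},
  forall (A B : {set T}) (f g : T -> T) (b : bool),
    (#|A| <= K)%N -> (#|B| <= K)%N ->
    (forall x y, x \in A -> y \in B -> ~~ ((f x \in A) && (g y \in B))) ->
  l * `|\sum_(x in A) \sum_(y in B) sign_on R _ (pair_map T f g) b s (x, y)|
    <= ln ((4 * #|T| ^ (4 * K))%:R) + 2 * l ^+ 2 * K%:R ^+ 2.
Proof.
move=> T0 l0 l2.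
pose U := {ffun 'I_K -> T * T}.
(* An index holds codes for [(A, f)] and [(B, g)], the bit [b] and a sign. *)
pose I : finType := (U * U * (bool * bool))%type.
pose D (i : I) := finset.setX (graph_dom T K i.1.1) (graph_dom T K i.1.2).
pose phi (i : I) := pair_map T (graph_app T K i.1.1) (graph_app T K i.1.2).
pose good (i : I) := [forall v in D i, phi i v \notin D i].
pose F (i : I) (s : {ffun T * T -> bool}) :=
  expR (((-1) ^+ i.2.2 * l) * \sum_(v in D i) sign_on R _ (phi i) i.2.1 s v).
pose M : R := #|I|%:R * expR (2 * l ^+ 2) ^+ (K * K).
have e1 : 1 <= expR (2 * l ^+ 2) by rewrite -expR0 ler_expR mulr_ge0// sqr_ge0.
have cI : #|I| = (4 * #|T| ^ (4 * K))%N.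
  rewrite !card_prod card_bool !card_ffun card_prod card_ord mulnC.
  rewrite -expnMn (expnM _ 4); congr (_ * _ ^ _)%N.
  by rewrite !expnS expn0 muln1 !mulnA.
have cD i : (#|D i| <= K * K)%N.
  rewrite cardsX leq_mul//; apply: leq_trans (leq_imset_card _ _) _;
    by rewrite cardT size_enum_ord.
have [s hs] : exists s, \sum_(i | good i) F i s <= M.
  apply: exists_le_mean.
    by rewrite card_ffun card_bool expn_gt0.
  rewrite exchange_big /= /M mulrCA.
  apply: (@le_trans _ _ (\sum_(i : I) (2 ^ #|{: T * T}|)%:R * expR (2 * l ^+ 2) ^+ (K * K))); last first.
    by rewrite [leRHS]mulr_natl sumr_const card_ffun card_bool.
  rewrite [leRHS](bigID good) /= -[leLHS]addr0 lerD//; last first.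
    by apply: sumr_ge0 => i _; rewrite mulr_ge0// exprn_ge0// expR_ge0.
  apply: ler_sum => i /forall_inP gi.
  have sq : ((-1) ^+ i.2.2 * l) ^+ 2 = l ^+ 2.
    by rewrite exprMn -exprM mulnC exprM sqrrN !expr1n mul1r.
  apply: (@le_trans _ _ ((2 ^ #|{: T * T}|)%:R * expR (2 * l ^+ 2) ^+ #|D i|)).
    rewrite -sq; apply: sum_expR_sign_le (subxx _) _ => //.
    by rewrite normrMsign gtr0_norm.
  by rewrite ler_wpM2l// ler_weXn2l.
exists s => A B f g b cA cB disj.
have c0 : 0 <= ln ((4 * #|T| ^ (4 * K))%:R) + 2 * l ^+ 2 * K%:R ^+ 2 :> R.
  rewrite addr_ge0//; last first.
    by apply: mulr_ge0; [apply: mulr_ge0 => //|]; exact: sqr_ge0.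
  by rewrite ln_ge0// ler1n muln_gt0 expn_gt0 T0.
(* [graph_ex] excludes empty sets; for those the sum is zero. *)
have [->|A0] := eqVneq A finset.set0.
  by rewrite big_set0 normr0 mulr0.
have [->|B0] := eqVneq B finset.set0.
  by rewrite big1 ?normr0 ?mulr0// => x _; rewrite big_set0.
have [u [uA uf]] := graph_ex T K A f A0 cA.
have [w [wB wg]] := graph_ex T K B g B0 cB.
set S := \sum_(x in A) _.
(* The sign bit is chosen to make the exponent [l] times the absolute value of [S]. *)
pose i : I := ((u, w), (b, S < 0)).
have gi : good i.
  apply/forall_inP => -[x y]; rewrite /D /= uA wB !inE /= => /andP[xA yB].
  by rewrite uf// wg// disj.
have FS : F i s = expR (l * `|S|).
  rewrite /F /=; congr expR.
  have -> : \sum_(v in D i) sign_on R _ (phi i) b s v = S.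
    rewrite /S pair_big /=; apply: eq_big => [[x y]|[x y]].
      by rewrite /D /= uA wB inE.
    rewrite /D /= uA wB inE /= => /andP[xA yB].
    by rewrite /sign_on /phi /pair_map /= uf// wg.
  case: ltrP => S0; first by rewrite ltr0_norm// expr1; ring.
  by rewrite ger0_norm// expr0 mul1r.
rewrite -ler_expR -FS expRD lnK; last by rewrite posrE ltr0n muln_gt0 expn_gt0 T0.
have -> : expR (2 * l ^+ 2 * K%:R ^+ 2) = expR (2 * l ^+ 2) ^+ (K * K).
  by rewrite -expRM_natl natrM -expr2 mulrC.
rewrite -cI; apply: le_trans hs; rewrite (bigD1 i)//= lerDl.
by apply: sumr_ge0 => j _; exact: expR_ge0.
Qed.

(** * Colourings, and passage from sets to mass functions *)

(* The colour of [x] is a position where [x] and [f x] differ, together with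
   the bit of [x] there. *)
Lemma no_fixed_point_coloring (n : nat) (f : n.-tuple bool -> n.-tuple bool) :
  no_fixed_point f ->
  exists col : n.-tuple bool -> 'I_n * bool, forall x, col (f x) != col x.
Proof.
move=> nf.
have dif x : exists i, tnth (f x) i != tnth x i.
  apply: contrapT => /forallNP h; apply: (nf x); apply: eq_from_tnth => i.
  by apply/eqP; apply: contrapT => /negP; exact: h.
pose i x := xchoose (dif x); exists (fun x => (i x, tnth x (i x))) => x.
(* Equal colours would make [x] and [f x] agree at the very position chosen because they differ
   there. *)
apply/negP => /eqP[e1 e2].
by move: (xchooseP (dif x)); rewrite -/(i x) -{1}e1 e2 eqxx.
Qed.

Lemma norm_sum_coloring_le (R : realType) (T C : finType) (col : T -> C)
    (A : {set T}) (F : T -> R) (r : R) :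
  (forall c, `|\sum_(x in [set x in A | col x == c]) F x| <= r) ->
  `|\sum_(x in A) F x| <= #|C|%:R * r.
Proof.
move=> h; rewrite (partition_big col predT)//= mulr_natl -sumr_const.
apply: le_trans (ler_norm_sum _ _ _) _; apply: ler_sum => c _.
rewrite (_ : \sum_(x in A | col x == c) F x =
  \sum_(x in [set x in A | col x == c]) F x)//.
by apply: eq_bigl => x; rewrite inE.
Qed.

(** At most [K] points have [a x > d], since [K] of them would violate the bound on sets. They
    contribute at most [d] because [p] is at most [1 / K], and the rest at most [d] because [p] has
    total mass 1. *)
Lemma sum_mass_le (R : realType) (T : finType) (K : nat) (p a : T -> R)
    (d : R) : (0 < K)%N -> 0 <= d -> (forall x, 0 <= p x) ->
  (forall x, p x <= K%:R^-1) -> \sum_x p x = 1 ->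
  (forall A : {set T}, (#|A| <= K)%N -> \sum_(x in A) a x <= d * K%:R) ->
  \sum_x p x * a x <= 2 * d.
Proof.
move=> K0 d0 p0 pK p1 h; pose G := [set x | d < a x].
have GK : (#|G| <= K)%N.
  rewrite leqNgt; apply/negP => KG.
  have /card_geqP[t [ut st tG]] := ltnW KG; pose A := [set x in t].
  have cA : #|A| = K by rewrite cardsE (card_uniqP ut).
  have := h A; rewrite cA leqnn => /(_ isT); apply/negP; rewrite -ltNge.
  rewrite mulr_natr -cA -sumr_const; apply: ltr_sum.
    have /card_gt0P[x xA] : (0 < #|A|)%N by rewrite cA.
    by apply/hasP; exists x; rewrite ?mem_index_enum.
  by move=> x; rewrite inE => /tG; rewrite inE.
rewrite (bigID (mem G)) /= mulr_natl mulr2n lerD//.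
  apply: (@le_trans _ _ (\sum_(x in G) K%:R^-1 * a x)).
    apply: ler_sum => x; rewrite inE => dx.
    by rewrite ler_wpM2r// (le_trans d0)// ltW.
  rewrite -mulr_sumr ler_pdivrMl ?ltr0n// mulrC.
  exact: h.
apply: (@le_trans _ _ (\sum_x p x * d)); last by rewrite -mulr_suml p1 mul1r.
rewrite [leRHS](bigID (mem G)) /= -[leLHS]add0r lerD//.
  by apply: sumr_ge0 => x _; rewrite mulr_ge0.
by apply: ler_sum => x; rewrite inE -leNgt => ad; rewrite ler_wpM2l.
Qed.

Lemma sum_mass2_le (R : realType) (T : finType) (K : nat) (p q : T -> R)
    (M : T -> T -> R) (d : R) : (0 < K)%N -> 0 <= d ->
  (forall x, 0 <= p x) -> (forall x, p x <= K%:R^-1) -> \sum_x p x = 1 ->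
  (forall x, 0 <= q x) -> (forall x, q x <= K%:R^-1) -> \sum_x q x = 1 ->
  (forall A B : {set T}, (#|A| <= K)%N -> (#|B| <= K)%N ->
    \sum_(x in A) \sum_(y in B) M x y <= d * K%:R ^+ 2) ->
  \sum_x \sum_y p x * q y * M x y <= 4 * d.
Proof.
move=> K0 d0 p0 pK p1 q0 qK q1 h.
have -> : \sum_x \sum_y p x * q y * M x y
    = \sum_x p x * (\sum_y q y * M x y).
  by apply: eq_bigr => x _; rewrite mulr_sumr; apply: eq_bigr => y _; rewrite mulrA.
have -> : 4 * d = 2 * (2 * d) by ring.
(* The outer use, in [x], has constant [2 * d]; for a fixed set [A] the inner one, in [y], has
   constant [d * K]. *)
apply: (@sum_mass_le R T K) => // [|A cA]; first by rewrite mulr_ge0.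
rewrite exchange_big /= -mulrA.
under eq_bigr do rewrite -mulr_sumr.
apply: (@sum_mass_le R T K) => // [|B cB]; first by rewrite mulr_ge0.
by rewrite exchange_big /= -mulrA -expr2 h.
Qed.

(** * The extractor for mass functions *)

(* With [l = delta / (8 n)] each of the [2 n] colour classes contributes at
   most [delta K^2 / (2 n)]. *)
Lemma exists_nonmalleable (R : realType) (n K : nat) (delta : R) :
    (0 < n)%N -> (0 < K)%N -> 0 < delta -> delta <= 1 ->
    192 * n%:R ^+ 3 <= delta ^+ 2 * K%:R ->
  exists s : {ffun n.-tuple bool * n.-tuple bool -> bool},
  forall f g : n.-tuple bool -> n.-tuple bool,
    no_fixed_point f \/ no_fixed_point g ->
  forall p q : n.-tuple bool -> R,
    (forall x, 0 <= p x) -> (forall x, p x <= K%:R^-1) -> \sum_x p x = 1 ->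
    (forall x, 0 <= q x) -> (forall x, q x <= K%:R^-1) -> \sum_x q x = 1 ->
  forall b : bool,
  `|\sum_x \sum_y p x * q y * sign_on R _ (pair_map _ f g) b s (x, y)|
    <= 4 * delta.
Proof.
move=> n0 K0 d0 d1 hK.
have nR : 1 <= n%:R :> R by rewrite ler1n.
have KR : 1 <= K%:R :> R by rewrite ler1n.
have n_gt0 : 0 < n%:R :> R by rewrite ltr0n.
pose l := delta / (8 * n%:R).
have l0 : 0 < l by rewrite divr_gt0// mulr_gt0.
have l2 : l <= 2^-1 by rewrite ler_pdivrMr ?mulr_gt0//; lra.
have cT : #|{: n.-tuple bool}| = (2 ^ n)%N by rewrite card_tuple card_bool.
have [|s hs] := exists_pseudorandom R (n.-tuple bool) K l _ l0 l2.
  by rewrite cT expn_gt0.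
exists s => f g fg.
pose r := delta * K%:R ^+ 2 / (2 * n%:R).
have rect (A B : {set n.-tuple bool}) b : (#|A| <= K)%N -> (#|B| <= K)%N ->
    (forall x y, x \in A -> y \in B -> ~~ ((f x \in A) && (g y \in B))) ->
    `|\sum_(x in A) \sum_(y in B) sign_on R _ (pair_map _ f g) b s (x, y)| <= r.
  move=> cA cB disj; rewrite -(ler_pM2l l0).
  apply: le_trans (hs A B f g b cA cB disj) _.
  have lnb : ln ((4 * #|{: n.-tuple bool}| ^ (4 * K))%:R) <= 6 * n%:R * K%:R :> R.
    have -> : (4 * #|{: n.-tuple bool}| ^ (4 * K) = 2 ^ (2 + n * (4 * K)))%N.
      by rewrite cT expnD -expnM.
    rewrite natrX lnXn//.
    have ln2 : ln 2 <= 1 :> R.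
      by rewrite -ler_expR lnK ?posrE//; exact: expR_ge1Dx.
    rewrite -[leLHS]mulr_natl natrD !natrM.
    have nK : 1 <= n%:R * K%:R :> R by rewrite -natrM ler1n muln_gt0 n0.
    apply: (@le_trans _ _ ((2 + n%:R * (4 * K%:R)) * 1)).
      by rewrite ler_wpM2l// addr_ge0 ?mulr_ge0//.
    lra.
  apply: le_trans (lerD lnb (lexx _)) _.
  have -> : l * r = delta ^+ 2 * K%:R ^+ 2 / (16 * n%:R ^+ 2).
    by rewrite /l /r; field; rewrite lt0r_neq0.
  rewrite ler_pdivlMr ?mulr_gt0 ?exprn_gt0//.
  (* Each of the two terms takes half of [l * r]: the first by the lower bound on [K], the second
     exactly, by the choice of [l]. *)
  have -> : (6 * n%:R * K%:R + 2 * l ^+ 2 * K%:R ^+ 2) * (16 * n%:R ^+ 2)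
    = (192 * n%:R ^+ 3) * K%:R / 2 + delta ^+ 2 * K%:R ^+ 2 / 2.
    by rewrite /l; field; rewrite lt0r_neq0.
  have : 192 * n%:R ^+ 3 * K%:R <= delta ^+ 2 * K%:R * K%:R.
    by rewrite ler_wpM2r.
  have -> : delta ^+ 2 * K%:R * K%:R = delta ^+ 2 * K%:R ^+ 2 by ring.
  lra.
have card2n : #|{: 'I_n * bool}|%:R * r = delta * K%:R ^+ 2.
  rewrite card_prod card_ord card_bool natrM /r; field; exact: lt0r_neq0.
have rectT (A B : {set n.-tuple bool}) b : (#|A| <= K)%N -> (#|B| <= K)%N ->
    `|\sum_(x in A) \sum_(y in B) sign_on R _ (pair_map _ f g) b s (x, y)|
      <= delta * K%:R ^+ 2.
  have sub (E : {set n.-tuple bool}) (P : pred (n.-tuple bool)) :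
      (#|E| <= K)%N -> (#|[set x in E | P x]| <= K)%N.
    by apply: leq_trans; rewrite subset_leq_card//; apply/fintype.subsetP => x; rewrite inE => /andP[].
  move=> cA cB; rewrite -card2n.
  (* Only a side without fixed point is split: its map leaves every colour class, so the rectangle
     is sent off itself whatever the other map does. *)
  case: fg => /no_fixed_point_coloring[col colP].
    apply: (norm_sum_coloring_le _ _ _ col) => c; apply: rect => //.
      exact: sub.
    move=> x y; rewrite !inE => /andP[_ /eqP cx] _.
    by apply/negP => /andP[/andP[_ /eqP cfx] _]; have := colP x; rewrite cfx cx eqxx.
  rewrite exchange_big /=.
  apply: (norm_sum_coloring_le _ _ _ col) => c; rewrite exchange_big; apply: rect => //.
    exact: sub.
  move=> x y _; rewrite !inE => /andP[_ /eqP cy].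
  by apply/negP => /andP[_ /andP[_ /eqP cgy]]; have := colP y; rewrite cgy cy eqxx.
(* The one-sided bound is applied to the form and to its negative. *)
move=> p q p0 pK p1 q0 qK q1 b; rewrite ler_norml lerNl -sumrN; apply/andP; split.
  under eq_bigr do (rewrite -sumrN; under eq_bigr do rewrite -mulrN).
  apply: (@sum_mass2_le R _ K) => //; first exact: ltW.
  move=> A B cA cB; under eq_bigr do rewrite sumrN.
  rewrite sumrN; apply: le_trans (rectT A B b cA cB).
  by rewrite -normrN ler_norm.
apply: (@sum_mass2_le R _ K) => //; first exact: ltW.
move=> A B cA cB; apply: le_trans (rectT A B b cA cB).
exact: ler_norm.
Qed.

(** * Laws of random variables, entropy and statistical distance *)

Lemma probability_preimage_sum (d : measure_display) (T : measurableType d)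
    (R : realType) (P : probability T R) (I : finType) (Z : T -> I)
    (h : pred I) : (forall i, measurable (Z @^-1` [set i])%classic) ->
  P [set w | h (Z w)]%classic = (\sum_(i | h i) P (Z @^-1` [set i])%classic)%E.
Proof.
move=> mZ; rewrite -big_filter.
have -> : [set w | h (Z w)]%classic =
    (\bigcup_(i in [set` [seq i <- index_enum I | h i]]) Z @^-1` [set i])%classic.
  apply/seteqP; split => [w /= hw|w [i]] /=.
    by exists (Z w) => //=; rewrite mem_filter hw mem_index_enum.
  by rewrite mem_filter => /andP[hi _] Zi; rewrite Zi.
rewrite measure_fin_bigcup//.
- by rewrite -fsbig_seq// filter_uniq// index_enum_uniq.
- by apply/trivIsetP => i j _ _ ij; apply/seteqP; split => // w [] /= -> /eqP; rewrite (negbTE ij).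
Qed.

(** Measurability of [X] is coordinatewise, and a point is a finite intersection of coordinate
    conditions. *)
Lemma measurable_preimage_tuple (d : measure_display) (T : measurableType d)
    (n : nat) (X : T -> n.-tuple bool) (x : n.-tuple bool) :
  measurable_fun [set: T]%classic X -> measurable (X @^-1` [set x])%classic.
Proof.
move=> /measurable_fun_tnthP mX.
have -> : (X @^-1` [set x] =
    \bigcap_(i in [set: 'I_n]) ((fun w => tnth (X w) i) @^-1` [set tnth x i]))%classic.
  apply/seteqP; split => [w /= Xw i _|w h]; first by rewrite /= Xw.
  by apply: eq_from_tnth => i; exact: (h i I).
apply: fin_bigcap_measurable => // i _.
by rewrite -[X in measurable X]setTI; exact: (mX i).
Qed.

Lemma law_ge0 (d : measure_display) (T : measurableType d) (R : realType)
  (P : probability T R) (A : finType) (X : T -> A) (a : A) : 0 <= law P X a.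
Proof. exact: fine_ge0. Qed.

Lemma sum_law (d : measure_display) (T : measurableType d) (R : realType)
    (P : probability T R) (A : finType) (X : T -> A) :
  (forall a, measurable (X @^-1` [set a])%classic) -> \sum_a law P X a = 1.
Proof.
move=> mX; rewrite /law sum_fine//; last first.
  by move=> a _; exact: fin_num_measure.
rewrite -(probability_preimage_sum _ _ _ P _ X predT mX).
rewrite [X in P X](_ : _ = [set: T]%classic); first by rewrite probability_setT.
by apply/seteqP; split.
Qed.

(** The event is a disjoint union of point events of the pair, on which independence factors the
    probability. *)
Lemma law_independent (d : measure_display) (T : measurableType d)
    (R : realType) (P : probability T R) (A B C : finType) (X : T -> A)
    (Y : T -> B) (h : A -> B -> C) (c : C) :
  (forall a, measurable (X @^-1` [set a])%classic) ->
  (forall b, measurable (Y @^-1` [set b])%classic) ->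
  independent P X Y ->
  law P (fun w => h (X w) (Y w)) c =
  \sum_a \sum_b law P X a * law P Y b * (h a b == c)%:R.
Proof.
move=> mX mY iXY; pose Z w := (X w, Y w).
have preZ a b : (Z @^-1` [set (a, b)] = X @^-1` [set a] `&` Y @^-1` [set b])%classic.
  by apply/seteqP; split => w; rewrite /Z /= => -[-> ->].
have mZ ab : measurable (Z @^-1` [set ab])%classic.
  by case: ab => a b; rewrite preZ; exact: measurableI.
rewrite {1}/law (_ : (_ @^-1` _)%classic
    = [set w | (fun ab => h ab.1 ab.2 == c) (Z w)]%classic); last first.
  by apply/seteqP; split => w /= /eqP.
rewrite (probability_preimage_sum _ _ _ P _ Z (fun ab => h ab.1 ab.2 == c) mZ).
rewrite -sum_fine; last by move=> i _; exact: fin_num_measure.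
rewrite pair_big /= big_mkcond; apply: eq_bigr => -[a b] _ /=.
case: eqP => _; last by rewrite mulr0.
by rewrite mulr1 preZ iXY fineM//; exact: fin_num_measure.
Qed.

(** Taking [K = n ^ c] turns entropy [c * log2 n] into the mass bound [1 / K] of the extractor. *)
Lemma law_le_of_min_entropy (R : realType) (A : finType) (p : A -> R) (k : R)
    (n c : nat) (a : A) : (0 < n)%N -> (forall a, 0 <= p a) ->
  c%:R * log2 (n%:R : R) <= k -> (k%:E <= min_entropy p)%E ->
  p a <= (n ^ c)%:R^-1.
Proof.
(* Min-entropy only sees the support; a point of mass zero is bounded trivially. *)
move=> n0 p0 ck km; have [->|pa] := eqVneq (p a) 0; first by rewrite invr_ge0.
have pa0 : 0 < p a by rewrite lt0r pa p0.
have nc0 : 0 < (n ^ c)%:R :> R by rewrite ltr0n expn_gt0 n0.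
rewrite -[leLHS]invrK lef_pV2 ?posrE ?invr_gt0//.
have ln2 : 0 < ln 2 :> R by rewrite ln_gt0// ltr1n.
have : c%:R * log2 (n%:R : R) <= log2 (1 / p a).
  rewrite -lee_fin; apply: le_trans (le_trans km _); first by rewrite lee_fin.
  exact: (bigmin_le_cond _ (fun a => (log2 (1 / p a))%:E)).
rewrite /log2 mulrA ler_pM2r ?invr_gt0// mul1r mulr_natl.
by rewrite -lnXn ?ltr0n// natrX ler_ln ?posrE ?invr_gt0// exprn_gt0// ltr0n.
Qed.

(** As [q] is the second marginal, for each [b] both first bits deviate by half of the same
    difference, up to sign. *)
Lemma stat_dist_unif_bit (R : realType) (B : finType) (p : bool * B -> R)
    (q : B -> R) :
  (forall b, q b = p (false, b) + p (true, b)) ->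
  stat_dist p (prod_law (@unif_bit R) q)
   = 2^-1 * \sum_b `|p (false, b) - p (true, b)|.
Proof.
move=> hq; congr (_ * _).
have -> : \sum_a `|p a - prod_law (@unif_bit R) q a|
    = \sum_(a : bool) \sum_b `|p (a, b) - 2^-1 * q b|.
  by rewrite pair_big; apply: eq_bigr => -[].
rewrite exchange_big /=.
apply: eq_bigr => b _; rewrite big_bool /= hq.
have -> : p (true, b) - 2^-1 * (p (false, b) + p (true, b)) =
  - ((p (false, b) - p (true, b)) / 2) by field.
have -> : p (false, b) - 2^-1 * (p (false, b) + p (true, b)) =
  (p (false, b) - p (true, b)) / 2 by field.
by rewrite normrN normrM (@ger0_norm _ 2^-1)//; field.
Qed.

(** * Choice of constants and transfer to the sources *)

Theorem theorem6p2 (R : realType) (eps : R) (eps_gt0 : 0 < eps) :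
  exists c : R, 1 < c /\
  exists nmExt2 : forall n : nat, n.-tuple bool -> n.-tuple bool -> bool,
  forall (n : nat), (2 <= n)%N ->
  forall (d : measure_display) (T : measurableType d) (P : probability T R)
    (X Y : {RV P >-> n.-tuple bool}) (k : R),
    independent P X Y ->
    c * log2 (n%:R : R) <= k ->
    (k%:E <= min_entropy (law P X))%E ->
    (k%:E <= min_entropy (law P Y))%E ->
  forall f g : n.-tuple bool -> n.-tuple bool,
    no_fixed_point f \/ no_fixed_point g ->
  stat_dist
    (law P (fun w => (nmExt2 n (X w) (Y w), nmExt2 n (f (X w)) (g (Y w)))))
    (prod_law (@unif_bit R) (law P (fun w => nmExt2 n (f (X w)) (g (Y w)))))
  <= eps.
Proof.
(* The minimum with 1 keeps [l = delta / (8 n)] at most 1/2. *)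
pose delta : R := Num.min (eps / 4) 1.
have delta0 : 0 < delta by rewrite lt_min ltr01 andbT divr_gt0.
have delta1 : delta <= 1 by rewrite ge_min lexx orbT.
have delta_eps : 4 * delta <= eps.
  by rewrite mulrC -ler_pdivlMr// ge_min lexx.
(* For [n >= 2], [192 / delta ^+ 2 < m < n ^ m], and the summand 3 in [c] absorbs [n ^ 3]. *)
pose m := Num.bound (192 / delta ^+ 2).
pose c := (3 + m)%N.
have cP n : (2 <= n)%N -> 192 * n%:R ^+ 3 <= delta ^+ 2 * (n ^ c)%:R :> R.
  move=> n2; have n3 : 0 < n%:R ^+ 3 :> R by rewrite exprn_gt0// ltr0n ltnW.
  rewrite expnD natrM natrX [leLHS]mulrC [leRHS]mulrCA ler_pM2l//.
  rewrite -ler_pdivrMl ?exprn_gt0// mulrC.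
  have h : 0 <= 192 / delta ^+ 2 by rewrite divr_ge0// exprn_ge0// ltW.
  apply: ltW; apply: lt_le_trans (archi_boundP h) _.
  by rewrite ler_nat ltnW// ltn_expl.
exists c%:R; split; first by rewrite ltr1n.
have ext n : exists s : {ffun n.-tuple bool * n.-tuple bool -> bool},
    (2 <= n)%N ->
  forall f g : n.-tuple bool -> n.-tuple bool,
    no_fixed_point f \/ no_fixed_point g ->
  forall p q : n.-tuple bool -> R,
    (forall x, 0 <= p x) -> (forall x, p x <= (n ^ c)%:R^-1) ->
    \sum_x p x = 1 ->
    (forall x, 0 <= q x) -> (forall x, q x <= (n ^ c)%:R^-1) ->
    \sum_x q x = 1 ->
  forall b : bool,
  `|\sum_x \sum_y p x * q y * sign_on R _ (pair_map _ f g) b s (x, y)|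
    <= 4 * delta.
  (* Lengths below 2 carry no requirement, so a constant function serves. *)
  have [n2|n2] := boolP (2 <= n)%N; last by exists [ffun=> false].
  have n0 : (0 < n)%N by apply: ltnW.
  have [|s hs] := exists_nonmalleable R n (n ^ c) delta n0 _ delta0 delta1 (cP n n2).
    by rewrite expn_gt0 n0.
  by exists s.
pose s n := projT1 (cid (ext n)).
exists (fun n x y => s n (x, y)) => n n2 d T P X Y k iXY ck kX kY f g fg.
have n0 : (0 < n)%N by apply: ltnW.
have mX x : measurable (X @^-1` [set x])%classic.
  exact/measurable_preimage_tuple/measurable_funPT.
have mY y : measurable (Y @^-1` [set y])%classic.
  exact/measurable_preimage_tuple/measurable_funPT.
have lawE := law_independent _ _ _ P _ _ _ X Y _ _ mX mY iXY.
rewrite stat_dist_unif_bit; last first.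
  move=> b.
  rewrite (lawE _ (fun x y => (s n (x, y), s n (f x, g y)))).
  rewrite (lawE _ (fun x y => (s n (x, y), s n (f x, g y)))).
  rewrite (lawE _ (fun x y => s n (f x, g y))).
  rewrite -big_split; apply: eq_bigr => x _ /=.
  rewrite -big_split; apply: eq_bigr => y _ /=.
  by rewrite -mulrDr !xpair_eqE; case: (s n (x, y)); rewrite /= ?add0r ?addr0.
apply: le_trans delta_eps.
(* Two values of [b], each giving at most [4 * delta], and the factor 1/2 leave [4 * delta]. *)
suff h b : `|law P (fun w => (s n (X w, Y w), s n (f (X w), g (Y w)))) (false, b) -
    law P (fun w => (s n (X w, Y w), s n (f (X w), g (Y w)))) (true, b)| <= 4 * delta.
  by rewrite big_bool /=; have := h true; have := h false; lra.
have /= := projT2 (cid (ext n)) n2 f g fg (law P X) (law P Y) (law_ge0 _ _ _ P _ X)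
  _ (sum_law _ _ _ P _ X mX) (law_ge0 _ _ _ P _ Y) _ (sum_law _ _ _ P _ Y mY) b.
have lX x : law P X x <= (n ^ c)%:R^-1.
  by apply: (law_le_of_min_entropy R _ _ k) => // a; exact: law_ge0.
have lY x : law P Y x <= (n ^ c)%:R^-1.
  by apply: (law_le_of_min_entropy R _ _ k) => // a; exact: law_ge0.
move=> /(_ lX lY); rewrite -/(s n).
rewrite !(lawE _ (fun x y => (s n (x, y), s n (f x, g y)))).
congr (`|_| <= _).
rewrite -sumrB; apply: eq_bigr => x _.
rewrite -sumrB; apply: eq_bigr => y _.
rewrite -mulrBr /sign_on /pair_map /= !xpair_eqE; congr (_ * _).
by case: (s n (x, y)); case: (_ == b); rewrite /= ?expr1 ?expr0; ring.
Qed.
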